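(* Let $X$ be a $\sigma$-compact Ascoli Tychonoff space. If $X$ is of $\mathbb{N}^{\mathbb{N}}$-uniformly compact type, then the free locally convex space $L(X)$ has a $\mathfrak{G}$-base.
   Context: $\mathbb{N}^{\mathbb{N}}$ is ordered coordinatewise: $\alpha\le\beta$ iff $\alpha(n)\le\beta(n)$ for all $n\in\mathbb{N}$. $\mathfrak{G}$-base: a topological space $Z$ has a $\mathfrak{G}$-base at $z\in Z$ if it has a base $\{U_\alpha:\alpha\in\mathbb{N}^{\mathbb{N}}\}$ of neighborhoods at $z$ such that $U_\beta\subseteq U_\alpha$ whenever $\alpha\le\beta$; $Z$ has a $\mathfrak{G}$-base if it has one at each of its points. Free locally convex space: $L(X)$ is a (real, Hausdorff) locally convex space together with a continuous map $i:X\to L(X)$ such that for every continuous map $f$ from $X$ to a locally convex space $E$ there is a unique continuous linear operator $\bar f:L(X)\to E$ with $f=\bar f\circ i$. It exists and is unique up to isomorphism. $C_k(X)$ is the space $C(X)$ of all continuous real-valued functions on $X$ with the compact-open topology. $X$ is an Ascoli space if every compact subset $\mathcal{K}$ of $C_k(X)$ is evenly continuous, i.e. the map $\mathcal{K}\times X\to\mathbb{R}$, $(f,x)\mapsto f(x)$, is continuous. $X$ is of $\mathbb{N}^{\mathbb{N}}$-uniformly compact type if for every compact $K\subseteq X$ the set $\Delta_K=\{(x,x)\in X\times X:x\in K\}$ has a base $\{U_\alpha:\alpha\in\mathbb{N}^{\mathbb{N}}\}$ of open neighborhoods in $X\times X$ (every open neighborhood $U$ of $\Delta_K$ satisfies $\Delta_K\subseteq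 U_\alpha\subseteq U$ for some $\alpha$) which is $\mathbb{N}^{\mathbb{N}}$-decreasing: $U_\beta\subseteq U_\alpha$ whenever $\alpha\le\beta$. *)

(* Defs.v *)
From HB Require Import structures.
From mathcomp Require Import all_boot all_order all_algebra.
From mathcomp Require Import all_classical all_reals all_analysis.

Set Implicit Arguments.
Unset Strict Implicit.
Unset Printing Implicit Defensive.

Import Order.TTheory GRing.Theory Num.Theory.
Import numFieldNormedType.Exports.

Local Open Scope classical_set_scope.
Local Open Scope ring_scope.

Definition NN_decreasing (T : Type) (U : (nat -> nat) -> set T) : Prop :=
  forall a b : nat -> nat, (forall n, (a n <= b n)%N) -> U b `<=` U a.

Definition has_Gbase_at (Z : topologicalType) (z : Z) : Prop :=
  exists U : (nat -> nat) -> set Z,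
    [/\ forall a, nbhs z (U a),
        forall V, nbhs z V -> exists a, U a `<=` V
      & NN_decreasing U].

Definition has_Gbase (Z : topologicalType) : Prop :=
  forall z : Z, has_Gbase_at z.

Definition sigma_compact (X : topologicalType) : Prop :=
  exists K : nat -> set X,
    (forall n, compact (K n)) /\ \bigcup_n K n = [set: X].

Definition tychonoff_space (X : topologicalType) : Prop :=
  hausdorff_space X /\ completely_regular_space X.

Definition diagonal_on (X : Type) (K : set X) : set (X * X) :=
  [set (x, x) | x in K].

Definition NN_uniformly_compact_type (X : topologicalType) : Prop :=
  forall K : set X, compact K ->
  exists U : (nat -> nat) -> set (X * X),
    [/\ forall a, open (U a) /\ diagonal_on K `<=` U a,
        forall V : set (X * X), open V -> diagonal_on K `<=` V ->
          exists a, U a `<=` V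
      & NN_decreasing U].

Section ascoli.
(* Equips [continuousType X R] with the compact-open topology: this is C_k(X). *)
Import ArrowAsCompactOpen.

Definition evenly_continuous (R : realType) (X : topologicalType)
    (K : set (continuousType X R)) : Prop :=
  {within K `*` [set: X], continuous (eval : continuousType X R * X -> R)}.

Definition ascoli_space (R : realType) (X : topologicalType) : Prop :=
  forall K : set (continuousType X R), compact K -> evenly_continuous K.

End ascoli.

(* The library's [tvsType R] is locally convex but not necessarily Hausdorff;
   its uniformity plays no role here. *)
Definition is_free_lcs (R : realType) (X : topologicalType)
    (L : tvsType R) (i : X -> L) : Prop :=
  [/\ hausdorff_space L,
      continuous i
    & forall (E : tvsType R), hausdorff_space E ->
      forall f : X -> E, continuous f ->
      exists! g : {linear L -> E}, continuous g /\ f = g \o i].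

(* Main.v *)
(** In the free locally convex space [L], an absolutely convex set [B] is a
neighborhood of [0] as soon as it absorbs every [i x] and, for every scalar
[e] and every [x], contains [e *: (i y - i x)] for [y] near [x]: give the
linear span of [i] the finest locally convex topology making [i] continuous;
the universal property yields a continuous map from [L] to this span which, by
uniqueness, is the identity.  Write [X] as the union of compact sets [K n] and
let [U n] be a decreasing base at the diagonal of [K n].  An index [a] encodes
bounds [m n] and indices [c n k]; the absolutely convex hull of the vectors
[i x / m n], [x] in [K n], and [k (i x - i y)], [(x, y)] in [U n (c n k)], is a
neighborhood of [0] by the criterion.  Every absolutely convex neighborhood
[W] of [0] contains such a hull, because [W] absorbs the compact sets
[i (K n)] and [k (i x - i y)] is in [W] near the diagonal. *)
Require Import Defs.
From HB Require Import structures.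
From mathcomp Require Import all_boot all_order all_algebra.
From mathcomp Require Import all_classical all_reals all_analysis.
From mathcomp Require Import lra.

Set Implicit Arguments.
Unset Strict Implicit.
Unset Printing Implicit Defensive.

Import Order.TTheory GRing.Theory Num.Theory.
Import numFieldNormedType.Exports.

Local Open Scope classical_set_scope.
Local Open Scope ring_scope.

(** * Absolutely convex and absorbing sets *)

Definition abs_convex (R : realType) (V : lmodType R) (B : set V) : Prop :=
  B 0 /\ forall a b x y, B x -> B y -> `|a| + `|b| <= 1 -> B (a *: x + b *: y).

Definition absorbing (R : realType) (V : lmodType R) (B : set V) : Prop :=
  forall x, exists2 c : R, 0 < c & B (c *: x).

Section abs_convex_theory.
Context (R : realType) (V : lmodType R).
Implicit Types B C : set V.

Lemma abs_convexZ B a x : abs_convex B -> `|a| <= 1 -> B x -> B (a *: x).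
Proof.
move=> [B0 Bc] a1 Bx; have := Bc a 0 x 0 Bx B0.
by rewrite normr0 !addr0 scaler0 addr0; exact.
Qed.

(** Stands in for halving an epsilon: the half-size set [[set v | B (2 *: v)]] added to itself stays
    in [B]. *)
Lemma abs_convex_half B x y :
  abs_convex B -> B (2 *: x) -> B (2 *: y) -> B (x + y).
Proof.
move=> [_ Bc] Bx By; have := Bc 2^-1 2^-1 _ _ Bx By.
rewrite !scalerA mulVf// !scale1r; apply.
by rewrite ger0_norm ?invr_ge0//; lra.
Qed.

Lemma abs_convexI B C : abs_convex B -> abs_convex C -> abs_convex (B `&` C).
Proof.
move=> [B0 Bc] [C0 Cc]; split=> // a b x y [Bx Cx] [By Cy] ab.
by split; [exact: Bc|exact: Cc].
Qed.

Lemma absorbingI B C : abs_convex B -> abs_convex C ->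
  absorbing B -> absorbing C -> absorbing (B `&` C).
Proof.
move=> Bc Cc Ba Ca x; have [b b0 Bb] := Ba x; have [c c0 Cb] := Ca x.
have m0 : 0 < Num.min b c by rewrite lt_min b0.
exists (Num.min b c) => //; split.
- rewrite -[Num.min b c](divfK (lt0r_neq0 b0)) -scalerA.
  apply: abs_convexZ => //.
  by rewrite gtr0_norm ?divr_gt0// ler_pdivrMr// mul1r ge_min lexx.
- rewrite -[Num.min b c](divfK (lt0r_neq0 c0)) -scalerA.
  apply: abs_convexZ => //.
  by rewrite gtr0_norm ?divr_gt0// ler_pdivrMr// mul1r ge_min lexx orbT.
Qed.

Lemma abs_convex_scale B (c : R) :
  abs_convex B -> abs_convex [set x | B (c *: x)].
Proof.
move=> [B0 Bc]; split=> /=; first by rewrite scaler0.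
move=> a b x y Bx By ab; rewrite scalerDr !scalerA ![c * _]mulrC -!scalerA.
exact: Bc.
Qed.

Lemma absorbing_scale B (c : R) : abs_convex B -> absorbing B ->
  absorbing [set x | B (c *: x)].
Proof. by move=> Bc Ba x; have [d d0 Bd] := Ba (c *: x);
  exists d => //=; rewrite scalerA mulrC -scalerA. Qed.

(** Lets absorption of generators pass to their whole linear span. *)
Lemma absorbed_submod_closed B : abs_convex B ->
  submod_closed [pred v : V | `[< exists2 c : R, 0 < c & B (c *: v) >]].
Proof.
move=> Bc; split.
  by apply/asboolP; exists 1; rewrite ?scaler0; first exact: ltr01; exact: Bc.1.
move=> a u v /asboolP [c c0 Bu] /asboolP [d d0 Bv].
apply/asboolP.
(* Each term of the minimum makes one of the coefficients [e * a / c] and [e / d] at most 1/2 in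
   absolute value; the [+ 1] avoids dividing by zero when [a] is 0. *)
pose e := Num.min (c / (2 * (`|a| + 1))) (d / 2).
have a1 : 0 < 2 * (`|a| + 1) by rewrite mulr_gt0// ltr_wpDl.
have e0 : 0 < e by rewrite lt_min !divr_gt0.
have eC : e <= c / (2 * (`|a| + 1)) by rewrite ge_min lexx.
have eD : e <= d / 2 by rewrite ge_min lexx orbT.
exists e => //.
have -> : e *: (a *: u + v) = (e * a / c) *: (c *: u) + (e / d) *: (d *: v).
  by rewrite !scalerA !divfK ?lt0r_neq0// scalerDr scalerA.
apply: Bc.2 => //.
rewrite !normrM !normfV (gtr0_norm c0) (gtr0_norm d0) (gtr0_norm e0).
have h2 : e / d <= 1 / 2 by rewrite ler_pdivrMr//; lra.
have h1 : e * `|a| / c <= 1 / 2.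
  rewrite ler_pdivrMr//; move: eC; rewrite ler_pdivlMr//.
  by rewrite mulrCA mulrDr mulr1 => ?; lra.
lra.
Qed.

Lemma smallest_abs_convex (G : set V) :
  abs_convex (smallest (@abs_convex R V) G).
Proof.
split; first by move=> B [[]].
move=> a b x y Gx Gy ab B BG; have [[_ Bc] _] := BG.
by apply: Bc => //; [exact: Gx|exact: Gy].
Qed.

End abs_convex_theory.

(** * The finest locally convex topology making a map continuous *)

Section finest_lc.
Context (R : realType) (X : topologicalType) (V : lmodType R).

(** The phantom argument [f] lets the topology attached to this alias depend on [f]. *)
Definition finest_lc (f : X -> V) : Type := V.

Variable f : X -> V.

(** Letting [e] range over all scalars makes the condition stable under rescaling [B]. *)
Definition continuous_mod (B : set V) : Prop :=
  forall x (e : R), \forall y \near x, B (e *: (f y - f x)).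

Definition lc_base (B : set V) : Prop :=
  [/\ abs_convex B, absorbing B & continuous_mod B].

Lemma lc_baseI B C : lc_base B -> lc_base C -> lc_base (B `&` C).
Proof.
move=> [Bc Ba Bf] [Cc Ca Cf]; split.
- exact: abs_convexI.
- exact: absorbingI.
- by move=> x e; apply: filterI; [exact: Bf|exact: Cf].
Qed.

Lemma lc_base_scale (c : R) B : lc_base B -> lc_base [set x | B (c *: x)].
Proof.
move=> [Bc Ba Bf]; split.
- exact: abs_convex_scale.
- exact: absorbing_scale.
- move=> x e; have := Bf x (c * e); apply: filterS => y /=.
  by rewrite scalerA.
Qed.

Lemma lc_baseT : lc_base setT.
Proof.
by split=> //; [move=> x; exists 1|move=> x e; apply: filterE].
Qed.

Definition lc_nbhs (x : V) : set_system V :=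
  [set A | exists2 B, lc_base B & forall v, B v -> A (x + v)].

HB.instance Definition _ := GRing.Lmodule.on (finest_lc f).
HB.instance Definition _ := hasNbhs.Build (finest_lc f) lc_nbhs.

Let nbhs_filter (p : finest_lc f) : ProperFilter (nbhs p).
Proof.
split.
  by move=> [B [[B0 _] _ _]] /(_ 0 B0).
split.
- by exists setT => //; exact: lc_baseT.
- move=> P Q [B Bb BP] [C Cb CQ]; exists (B `&` C); first exact: lc_baseI.
  by move=> v [Bv Cv]; split; [exact: BP|exact: CQ].
- by move=> P Q PQ [B Bb BP]; exists B => // v /BP/PQ.
Qed.

Let nbhs_singleton (p : finest_lc f) (A : set (finest_lc f)) : nbhs p A -> A p.
Proof. by move=> [B [[B0 _] _ _]] /(_ _ B0); rewrite addr0. Qed.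

Let nbhs_nbhs (p : finest_lc f) (A : set (finest_lc f)) :
  nbhs p A -> nbhs p (nbhs^~ A).
Proof.
move=> [B Bb BA]; exists [set v | B (2 *: v)]; first exact: lc_base_scale.
move=> v /= Bv; exists [set v | B (2 *: v)]; first exact: lc_base_scale.
by move=> w /= Bw; rewrite -addrA; apply: BA; apply: abs_convex_half => //;
  case: Bb.
Qed.

HB.instance Definition _ := Nbhs_isNbhsTopological.Build (finest_lc f)
  nbhs_filter nbhs_singleton nbhs_nbhs.

Let add_cont : continuous (fun x : finest_lc f * finest_lc f => x.1 + x.2).
Proof.
move=> [x y] A /= [B Bb BA].
pose H := [set v | B (2 *: v)].
have Hb : lc_base H by exact: lc_base_scale.
exists ([set x + v | v in H], [set y + v | v in H]).
  by split; exists H => // v Hv; exists v.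
move=> [_ _] /= [[v Hv <-] [w Hw <-]] /=.
rewrite addrACA; apply: BA; apply: abs_convex_half => //; by case: Bb.
Qed.

Let scale_cont : continuous (fun z : R^o * finest_lc f => z.1 *: z.2).
Proof.
move=> [r x] A /= [B Bb BA].
have [Bc Ba _] := Bb.
have [d d0 Bd] := Ba x.
(* The increment [s *: v + (s - r) *: x] is a combination of [c *: v] and [d *: x], both in [B].
   When [s] is within [d / 2] of [r], the constant [c] keeps both coefficients at most 1/2. *)
pose c := 2 * (`|r| + d).
have c0 : 0 < c by rewrite mulr_gt0// ltr_wpDl.
pose H := [set v | B (c *: v)].
have Hb : lc_base H by exact: lc_base_scale.
exists ([set s | `|r - s| < d / 2], [set x + v | v in H]).
  split; last by exists H => // v Hv; exists v.
  by exists (d / 2) => /=; first exact: divr_gt0.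
move=> [s _] /= [rs [v Hv <-]] /=.
have -> : s *: (x + v) =
    r *: x + ((s / c) *: (c *: v) + ((s - r) / d) *: (d *: x)).
  rewrite !scalerA !divfK ?lt0r_neq0// scalerDr scalerBl.
  by rewrite [RHS]addrC -addrA subrK addrC.
apply: BA; apply: Bc.2 => //.
rewrite !normrM !normfV (gtr0_norm c0) (gtr0_norm d0) (distrC s).
have sr : `|s| <= `|r| + d.
  rewrite -[s](subrK r) addrC (le_trans (ler_normD _ _))// lerD2l distrC.
  by rewrite ltW// (lt_trans rs)//; lra.
have h1 : `|s| / c <= 1 / 2 by rewrite ler_pdivrMr// /c; lra.
have h2 : `|r - s| / d <= 1 / 2 by rewrite ler_pdivrMr//; lra.
by lra.
Qed.

Let convexW (A : set (finest_lc f)) : abs_convex A ->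
  forall (x y : V) (t : R), 0 <= t -> t <= 1 -> A x -> A y ->
  A (t *: x + (1 - t) *: y).
Proof.
move=> [_ Ac] x y t t0 t1 Ax Ay; apply: Ac => //.
by rewrite !ger0_norm ?subr_ge0//; lra.
Qed.

Let loc_convex : exists2 B : set_system (finest_lc f),
  (forall b, b \in B -> convex_set b) & basis B.
Proof.
exists [set A : set (finest_lc f) | open A /\ convex_set A].
  by move=> A /[!inE] -[].
split; first by move=> A [].
move=> x A [B Bb BA].
(* This is the interior of the translate [x + B]; it inherits convexity from [B]. *)
pose W := [set y | exists2 C, lc_base C & forall v, C v -> B (y - x + v)].
exists W; last first.
  move=> y [C [[C0 _] _ _]] /(_ 0 C0); rewrite addr0 => /BA.
  by rewrite addrCA subrr addr0.
split; last by exists B => //= v; rewrite subrr add0r.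
split.
  rewrite openE => y [C Cb CB].
  exists [set v | C (2 *: v)]; first exact: lc_base_scale.
  move=> v /= Cv; exists [set v | C (2 *: v)]; first exact: lc_base_scale.
  move=> w /= Cw; rewrite (addrAC y) -[_ + v + w]addrA.
  by apply: CB; apply: abs_convex_half => //; case: Cb.
move=> y z t; rewrite !inE => -[C Cb CB] [D Db DB].
exists (C `&` D); first exact: lc_baseI.
move=> v [Cv Dv].
have t0 : 0 <= t%:num by [].
have t1 : t%:num <= 1 by [].
have := @convexW B _ _ _ _ t0 t1 (CB v Cv) (DB v Dv).
case: Bb => Bc _ _ /(_ Bc).
congr B; rewrite -[conv t y z]/(t%:num *: (y : V) + (1 - t%:num) *: (z : V)).
have tE (u : V) : t%:num *: u + (1 - t%:num) *: u = u.
  by rewrite -scalerDl addrCA subrr addr0 scale1r.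
by rewrite !scalerDr addrACA tE; congr (_ + v); rewrite addrACA tE.
Qed.

(* This factory only builds the uniform structure out of its three fields, hence
   the three further instances. *)
HB.instance Definition _ := PreTopologicalLmod_isTvs.Build R (finest_lc f)
  add_cont scale_cont loc_convex.
HB.instance Definition _ :=
  PreTopologicalNmodule_isTopologicalNmodule.Build (finest_lc f) add_cont.
HB.instance Definition _ :=
  TopologicalNmodule_isTopologicalLmodule.Build R (finest_lc f) scale_cont.
HB.instance Definition _ := Uniform_isTvs.Build R (finest_lc f) loc_convex.

Lemma finest_lc_continuous : continuous (f : X -> finest_lc f).
Proof.
move=> x A [B [_ _ Bf] BA]; have := Bf x 1.
apply: filterS => y; rewrite scale1r => /BA.
by rewrite addrCA subrr addr0.
Qed.

End finest_lc.

(** * Absolutely convex neighborhoods of 0 *)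

Section tvs_abs_convex.
Context (R : realType) (L : tvsType R).

Lemma nbhs0_absorbing (W : set L) : nbhs 0 W -> absorbing W.
Proof.
move=> W0 x.
have := @scale_continuous R L (0, x) W; rewrite /= scale0r => /(_ W0).
move=> [[P Q] /= [P0 Qx] PQ].
have [e /= e0 Pe] := P0.
exists (e / 2); first exact: divr_gt0.
apply: (PQ (e / 2, x)); split => /=; last exact: nbhs_singleton.
by apply: Pe => /=; rewrite sub0r normrN gtr0_norm ?divr_gt0//; lra.
Qed.

(** A convex open [U] around 0 inside [A] is made symmetric by intersecting it with its opposite. *)
Lemma abs_convex_nbhs0 (A : set L) : nbhs 0 A ->
  exists W, [/\ abs_convex W, nbhs 0 W & W `<=` A].
Proof.
move=> A0; have [B Bc [Bo Bb]] := @locally_convex R L.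
have [U [BU U0] UA] := Bb 0 A A0.
have Uc (t : R) x y : 0 <= t -> t <= 1 -> U x -> U y ->
    U (t *: x + (1 - t) *: y).
  move=> t0 t1 Ux Uy.
  have := Bc U (mem_set BU) x y (Itv01 t0 t1) (mem_set Ux) (mem_set Uy).
  by rewrite inE.
have pos_comb (a b : R) x y : 0 <= a -> 0 <= b -> a + b <= 1 -> U x -> U y ->
    U (a *: x + b *: y).
  move=> a0 b0 ab Ux Uy.
  have [s0|s0] := eqVneq (a + b) 0.
    have -> : a = 0 by lra.
    have -> : b = 0 by lra.
    by rewrite !scale0r addr0.
  have s_gt0 : 0 < a + b by rewrite lt_neqAle eq_sym s0 addr_ge0.
  (* Normalize to a convex combination of [x] and [y], then shrink it towards 0, which lies in
     [U]. *)
  have -> : a *: x + b *: y = (a + b) *: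
      ((a / (a + b)) *: x + (1 - a / (a + b)) *: y) + (1 - (a + b)) *: 0.
    have ea : (a + b) * (a / (a + b)) = a by rewrite mulrC divfK.
    by rewrite scaler0 addr0 scalerDr !scalerA mulrBr mulr1 ea addrAC subrr add0r.
  apply: (Uc) => //; first exact: ltW.
  apply: (Uc) => //; first by rewrite divr_ge0// ltW.
  by rewrite ler_pdivrMr// mul1r lerDl.
have comb (a b : R) x y : U x -> U (- x) -> U y -> U (- y) ->
    `|a| + `|b| <= 1 -> U (a *: x + b *: y).
  move=> Ux UNx Uy UNy ab.
  (* The sign of a scalar moves onto the vector, which reduces to nonnegative coefficients. *)
  have sg (c : R) v : U v -> U (- v) -> exists2 w, U w & c *: v = `|c| *: w.
    move=> Uv UNv; have [c0|c0] := leP 0 c; first by exists v; rewrite ?ger0_norm.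
    by exists (- v) => //; rewrite ltr0_norm// scalerN scaleNr opprK.
  have [x' Ux' ->] := sg a x Ux UNx; have [y' Uy' ->] := sg b y Uy UNy.
  exact: pos_comb.
exists (U `&` -%R @` U); split; last by move=> x [/UA].
- split; first by split=> //; exists 0; rewrite ?oppr0.
  move=> a b x y [Ux [x1 Ux1 Ex]] [Uy [y1 Uy1 Ey]] ab; subst x y.
  split; first by apply: comb; rewrite ?opprK.
  exists (a *: x1 + b *: y1); first exact: comb.
  by rewrite !scalerN -opprD.
- have nU : nbhs 0 U by rewrite nbhsE; exists U => //; split=> //; exact: Bo.
  by apply: filterI => //; exact: nbhs0N.
Qed.

Lemma nbhs0_scale (e : R) (W : set L) : nbhs 0 W -> nbhs 0 [set v | W (e *: v)].
Proof.
move=> W0; have := @scale_continuous R L (e, 0) W.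
rewrite /= scaler0 => /(_ W0) [[P Q] /= [Pe Q0] PQ].
by apply: filterS Q0 => v Qv; apply: (PQ (e, v)); split => //=;
  exact: nbhs_singleton.
Qed.

Lemma continuous_nbhs0_mod (X : topologicalType) (f : X -> L) (W : set L) :
  continuous f -> nbhs 0 W -> continuous_mod f W.
Proof.
move=> cf W0 x e; have := nbhsT (f x) (nbhs0_scale e W0).
move=> /(cf x) Wx; near=> y.
have : (f @^-1` [set f x + v | v in [set v | W (e *: v)]]) y by near: y.
by move=> [v /= Wv <-]; rewrite addrAC subrr add0r.
Unshelve. all: by end_near.
Qed.

End tvs_abs_convex.

(** * The linear span as a module of its own *)

Section linear_span.
Context (R : realType) (X : Type) (V : lmodType R).

(** Intersecting submodules avoids finite sums and makes the induction principle [span_ind]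
    immediate. *)
Definition linear_span (f : X -> V) : {pred V} :=
  fun v => `[< forall S : {pred V}, submod_closed S ->
               (forall x, f x \in S) -> v \in S >].

Variable f : X -> V.

Lemma linear_span_submod_closed : submod_closed (linear_span f).
Proof.
split; first by apply/asboolP => S [S0 _] _.
move=> a u v /asboolP us /asboolP vs; apply/asboolP => S Sc fS.
by apply: Sc.2; [exact: us|exact: vs].
Qed.

HB.instance Definition _ :=
  GRing.isSubmodClosed.Build R V (linear_span f) linear_span_submod_closed.

Definition span_type := {v | v \in linear_span f}.

HB.instance Definition _ := Choice.on span_type.
HB.instance Definition _ := SubChoice.on span_type.
HB.instance Definition _ := [SubChoice_isSubLmodule of span_type by <:].

Definition span_val (v : span_type) : V := val v.

Let span_val_linear : linear span_val.
Proof. by move=> a u v; rewrite /span_val linearP. Qed.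

HB.instance Definition _ :=
  GRing.isLinear.Build R span_type V *:%R span_val span_val_linear.

Lemma span_val_inj : injective span_val.
Proof. exact: val_inj. Qed.

Lemma mem_linear_span x : f x \in linear_span f.
Proof. by apply/asboolP. Qed.

Definition to_span x : span_type := exist _ (f x) (mem_linear_span x).

Lemma span_ind (S : {pred V}) : submod_closed S -> (forall x, f x \in S) ->
  forall v, span_val v \in S.
Proof. by move=> Sc fS v; have /asboolP := valP v; exact. Qed.

End linear_span.

(** * Recognizing neighborhoods of 0 in the free locally convex space *)

Section free_lcs.
Context (R : realType) (X : topologicalType) (L : tvsType R) (i : X -> L).

Lemma lc_base_span (B : set L) : abs_convex B ->
  (forall x, exists2 c : R, 0 < c & B (c *: i x)) -> continuous_mod i B ->
  lc_base (to_span i) [set v | B (span_val v)].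
Proof.
move=> Bc Ba Bi; split.
- split=> [|a b u v Bu Bv ab /=].
    by rewrite /= linear0; exact: Bc.1.
  by rewrite linearD !linearZ; apply: Bc.2.
- move=> v.
  have /asboolP [c c0 Bcv] := span_ind (absorbed_submod_closed Bc)
    (fun x => asboolT (Ba x)) v.
  by exists c => //=; rewrite linearZ.
- by move=> y e; apply: filterS (Bi y e) => z Bz; rewrite /= linearZ linearB.
Qed.

Hypothesis free_i : is_free_lcs i.

Let E : tvsType R := finest_lc (to_span i).

Let val_continuous : continuous (@span_val R X L i : E -> L).
Proof.
have [_ ci _] := free_i.
move=> x A nA.
have A0 : nbhs 0 [set v | A (span_val x + v)].
  have := nbhsB (- span_val x) nA; rewrite addNr.
  apply: filterS => _ [v Av <-] /=.
  by rewrite addrA subrr add0r.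
have [W [Wc W0 WA]] := abs_convex_nbhs0 A0.
(* The trace on the span of an absolutely convex neighborhood of 0 in [L] belongs to the base of the
   finest topology. *)
exists [set v : span_type i | W (span_val v)]; last first.
  by move=> v /= /WA /=; rewrite -linearD.
apply: lc_base_span => //; last exact: continuous_nbhs0_mod.
by move=> y; exact: nbhs0_absorbing.
Qed.

Let E_hausdorff : hausdorff_space E.
Proof.
have [hL _ _] := free_i.
move=> p q clpq; apply/span_val_inj/hL => A B nA nB.
have [z [Az Bz]] := clpq _ _ (val_continuous nA) (val_continuous nB).
by exists (span_val z).
Qed.

Lemma free_lcs_nbhs0 (B : set L) : abs_convex B ->
  (forall x, exists2 c : R, 0 < c & B (c *: i x)) ->
  continuous_mod i B -> nbhs 0 B.
Proof.
move=> Bc Ba Bi; have [hL ci univ] := free_i.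
have [g [[cg ig] _]] := univ E E_hausdorff _
  (@finest_lc_continuous R X _ (to_span i)).
have [h [_ uh]] := univ L hL i ci.
(* Both [span_val \o g] and the identity extend [i] to a continuous linear map [L -> L]. *)
have vg (v : L) : span_val (g v) = v.
  pose j : {linear L -> L} :=
    @span_val R X L i \o (g : {linear L -> span_type i}).
  have hj : h = j.
    apply: uh; split.
      by move=> x; apply: (@continuous_comp L E L g (@span_val R X L i));
        [exact: cg|exact: val_continuous].
    apply/funext => x.
    by have /(congr1 (fun k => span_val (k x))) := ig.
  have hid : h = idfun.
    by apply: uh; split=> // x; exact: cvg_id.
  by rewrite -[span_val (g v)]/(j v) -hj hid.
(* The trace of [B] is a neighborhood of 0 in [E], and its preimage under [g] is [B] itself by
   [vg]. *)
have nB : nbhs (g 0) [set v : E | B (span_val v)].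
  rewrite linear0; exists [set v : span_type i | B (span_val v)].
    exact: lc_base_span.
  by move=> v /=; rewrite add0r.
have : nbhs 0 (g @^-1` [set v : E | B (span_val v)]) by exact: cg.
by apply: filterS => v /=; rewrite vg.
Qed.

End free_lcs.

(** Near each point of [K] one bound works for all large [m]; compactness, in its near-covering
    form, makes the bound uniform. *)
Lemma compact_absorbed (R : realType) (X : topologicalType) (L : tvsType R)
    (f : X -> L) (K : set X) (W : set L) :
  compact K -> continuous f -> abs_convex W -> nbhs 0 W ->
  exists m : nat, forall x, K x -> W (m.+1%:R^-1 *: f x).
Proof.
move=> /compact_near_coveringP cK cf Wc W0.
have [] := cK nat \oo (fun m x => W (m.+1%:R^-1 *: f x)) _; last first.
  by move=> m _ mK; exists m => x Kx; apply: (mK m) => //=.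
move=> x Kx; have [c c0 Wx] := nbhs0_absorbing W0 (f x).
have Wy := continuous_nbhs0_mod cf W0 x 1.
(* The two coefficients used below are [c^-1 / m.+1] and [1 / m.+1]; this bound makes their sum at
   most 1. *)
have Nm : \forall m \near \oo, (c^-1 + 1 <= m.+1%:R :> R).
  exists (Num.truncn (c^-1 + 1)) => // m /= hm.
  by rewrite (le_trans (ltW (truncnS_gt _)))// ler_nat ltnS.
exists ([set y | W (1 *: (f y - f x))], [set m | c^-1 + 1 <= m.+1%:R :> R]) => //.
move=> [y m] /= [Wyx cm].
have m0 : 0 < m.+1%:R :> R by rewrite ltr0n.
have -> : m.+1%:R^-1 *: f y = (m.+1%:R^-1 / c) *: (c *: f x) +
    m.+1%:R^-1 *: (1 *: (f y - f x)).
  by rewrite !scalerA divfK ?lt0r_neq0// mulr1 scalerBr addrCA subrr addr0.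
apply: Wc.2 => //.
rewrite !normrM !normfV (gtr0_norm c0) (gtr0_norm m0).
rewrite -[X in _ + X]mulr1 -mulrDr mulrC ler_pdivrMr//; lra.
Qed.

(** * Absolutely convex hulls indexed by sequences *)

Section hull_base.
Context (R : realType) (X : topologicalType) (L : tvsType R) (i : X -> L).
Variables (K : nat -> set X) (U : nat -> (nat -> nat) -> set (X * X)).

(** Coding triples by [pickle] packs countably many sequences into one; as only coordinates are
    read, the order is preserved. *)
Definition slice (a : nat -> nat) (n k m : nat) : nat := a (pickle (n, k, m)).

(* [slice a n 0 0] bounds the hull on [K n], and [slice a n k.+1] is the index
   of the neighborhood of the diagonal of [K n] used at precision [1 / k.+1]. *)
Definition generators (a : nat -> nat) : set L :=
  [set v | (exists n x, K n x /\ v = (slice a n 0 0).+1%:R^-1 *: i x) \/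
           (exists n k x y, U n (slice a n k.+1) (x, y) /\
                            v = k.+1%:R *: (i x - i y))].

Definition hull (a : nat -> nat) : set L :=
  smallest (@abs_convex R L) (generators a).

(** A larger index shortens the generators of the first kind and leaves fewer of the second, so all
    of them stay in the former hull. *)
Lemma hull_decreasing : (forall n, NN_decreasing (U n)) -> NN_decreasing hull.
Proof.
move=> Udec a b ab; apply: smallest_sub; first exact: smallest_abs_convex.
move=> _ [[n [x [Kx ->]]]|[n [k [x [y [Uxy ->]]]]]].
- set p := (slice a n 0 0).+1; set q := (slice b n 0 0).+1.
  have pq : (p <= q)%N by rewrite ltnS; exact: ab.
  have -> : q%:R^-1 *: i x = (p%:R / q%:R) *: (p%:R^-1 *: i x).
    by rewrite scalerA mulrAC mulfV ?pnatr_eq0// mul1r.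
  apply: (@abs_convexZ _ _ (hull a)).
  + exact: smallest_abs_convex.
  + by rewrite ger0_norm ?divr_ge0// ler_pdivrMr ?ltr0n// mul1r ler_nat.
  + by apply: sub_gen_smallest; left; exists n, x.
- apply: sub_gen_smallest; right; exists n, k, x, y; split=> //.
  by apply: (Udec n) Uxy => m; exact: ab.
Qed.

Lemma hull_nbhs0 a : is_free_lcs i -> \bigcup_n K n = setT ->
  (forall n b, open (U n b) /\ diagonal_on (K n) `<=` U n b) ->
  nbhs 0 (hull a).
Proof.
move=> free_i KX Uo; apply: (free_lcs_nbhs0 free_i).
- exact: smallest_abs_convex.
- move=> x; have [n _ Kx] : (\bigcup_n K n) x by rewrite KX.
  exists (slice a n 0 0).+1%:R^-1; first by rewrite invr_gt0 ltr0n.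
  by apply: sub_gen_smallest; left; exists n, x.
- move=> x e; have [n _ Kx] : (\bigcup_n K n) x by rewrite KX.
  (* Precision [k.+1] dominates [|e|], so [e *: (i y - i x)] is a generator times a scalar of
     absolute value at most 1. *)
  pose k := Num.truncn `|e|.
  have ek : `|e| <= k.+1%:R by rewrite ltW// truncnS_gt.
  have [oU dU] := Uo n (slice a n k.+1).
  have : nbhs (x, x) (U n (slice a n k.+1)).
    by apply: open_nbhs_nbhs; split=> //; apply: dU; exists x.
  move=> [[P Q] /= [Px Qx] PQ]; apply: filterS Qx => y Qy.
  have -> : e *: (i y - i x) = (- e / k.+1%:R) *: (k.+1%:R *: (i x - i y)).
    by rewrite scalerA divfK ?pnatr_eq0// scaleNr -scalerN opprB.
  apply: (@abs_convexZ _ _ (hull a)).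
  + exact: smallest_abs_convex.
  + rewrite normrM normrN normfV (@ger0_norm _ k.+1%:R)//.
    by rewrite ler_pdivrMr ?ltr0n// mul1r.
  + apply: sub_gen_smallest; right; exists n, k, x, y; split=> //.
    by apply: (PQ (x, y)); split=> //=; exact: nbhs_singleton.
Qed.

Lemma hull_cofinal (A : set L) : continuous i -> (forall n, compact (K n)) ->
  (forall n (V : set (X * X)), open V -> diagonal_on (K n) `<=` V ->
     exists a, U n a `<=` V) ->
  nbhs 0 A -> exists a, hull a `<=` A.
Proof.
move=> ci cK Ubase /abs_convex_nbhs0 [W [Wc W0 WA]].
have [m mW] := choice (fun n => compact_absorbed (cK n) ci Wc W0).
have nearU (nk : nat * nat) : exists a, U nk.1 a `<=`
    [set xy | W (nk.2.+1%:R *: (i xy.1 - i xy.2))].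
  case: nk => n k /=.
  pose V := [set xy : X * X | W (k.+1%:R *: (i xy.1 - i xy.2))].
  (* The base is cofinal among open sets only. The interior of [V] contains the diagonal of [K n]
     because [i xy.1 - i xy.2] is continuous and vanishes there. *)
  have [||a aV] := Ubase n (interior V).
  - exact: open_interior.
  - move=> _ [x Kx <-].
    have : continuous_mod (fun xy : X * X => i xy.1 - i xy.2) W.
      apply: continuous_nbhs0_mod W0 => z.
      apply: (@continuous_comp _ (L * L)%type L
        (fun xy : X * X => (i xy.1, i xy.2))
        (fun p => p.1 - p.2)); last exact: sub_continuous.
      apply: cvg_pair => /=.
      + by apply: (@continuous_comp _ X L fst i); [exact: cvg_fst|exact: ci].
      + by apply: (@continuous_comp _ X L snd i); [exact: cvg_snd|exact: ci].
    move=> /(_ (x, x) k.+1%:R); apply: filterS => z /=.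
    by rewrite subrr subr0.
  - by exists a; apply: subset_trans aV _; exact: interior_subset.
have [c cU] := choice nearU.
(* Third coordinate 0 stores the bound [m n] and [k'.+1] stores the index for precision [k'.+1]; the
   default 0 sits at non-codes, which [slice] never reads. *)
pose a j := if unpickle j is Some (n, k, l) then
  if k is k'.+1 then c (n, k') l else m n else 0%N.
exists a; apply: subset_trans WA; apply: smallest_sub => //.
move=> _ [[n [x [Kx ->]]]|[n [k [x [y [Uxy ->]]]]]].
- by rewrite /slice /a pickleK; exact: mW.
- apply: (cU (n, k) (x, y)); move: Uxy; congr (U n _ _).
  by apply/funext => l; rewrite /slice /a pickleK.
Qed.

End hull_base.

Theorem theorem1p7 (R : realType) (X : topologicalType)
    (L : tvsType R) (i : X -> L) :
  tychonoff_space X -> sigma_compact X -> ascoli_space R X ->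
  NN_uniformly_compact_type X ->
  is_free_lcs i ->
  has_Gbase L.
Proof.
move=> _ [K [cK KX]] _ uX free_i z.
have [_ ci _] := free_i.
have [U Ubase] := choice (fun n => uX _ (cK n)).
(* Translation carries the base at 0 to [z]. *)
exists (fun a => [set z + v | v in hull i K U a]); split.
- move=> a; apply: nbhsT; apply: hull_nbhs0 => // n b.
  by have [+ _ _] := Ubase n; exact.
- move=> V /(nbhsB (- z)); rewrite addNr => V0.
  have [|a aV] := @hull_cofinal R X L i K U _ ci cK _ V0.
    by move=> n; have [_ + _] := Ubase n.
  exists a => _ [v /aV [w Vw <-] <-].
  by rewrite addrA subrr add0r.
- move=> a b ab _ [v hv <-]; exists v => //.
  by apply: hull_decreasing hv => // n; have [] := Ubase n.
Qed.
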